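(* Let $E$, $F$ be countable Borel equivalence relations on the standard Borel spaces $X$, $Y$, respectively, let $\mathbf{A}=(A_-,A_+,A)$ be an invariant relation, and let $\Phi$ be a property of families $\mathcal{F}\subset A_+$. (i) If $E$ is Borel non-$(\mathbf{A},\Phi)$ and $B\subset X$ is Borel, then $E\upharpoonright B$ is Borel non-$(\mathbf{A},\Phi)$. (ii) If $E\leq_B F$ and $F$ is Borel non-$(\mathbf{A},\Phi)$, then $E$ is Borel non-$(\mathbf{A},\Phi)$. (iii) If $B\subset X$ is a Borel subset that is full for $E$ and $E\upharpoonright B$ is Borel non-$(\mathbf{A},\Phi)$, then $E$ is Borel non-$(\mathbf{A},\Phi)$. (iv) If $X=Y$, $E\subset F$, $F$ is smooth over $E$, and $E$ is Borel non-$(\mathbf{A},\Phi)$, then $F$ is Borel non-$(\mathbf{A},\Phi)$. (v) If $X=Y$, $E\subset F$, $F$ is Borel non-$(\mathbf{A},\Phi)$, and the property $\Phi$ is closed under unions, then $E$ is Borel non-$(\mathbf{A},\Phi)$.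
   Context: A Borel equivalence relation is countable if all its classes are countable. If $E$, $F$ are equivalence relations on standard Borel spaces $X$, $Y$, a Borel homomorphism from $E$ to $F$ (written $f\colon E\to F$) is a Borel function $f\colon X\to Y$ such that $x\mathrel{E}x'$ implies $f(x)\mathrel{F}f(x')$; $E\leq_B F$ means that there is a Borel $f\colon X\to Y$ with $x\mathrel{E}x'\iff f(x)\mathrel{F}f(x')$. $E\upharpoonright B$ denotes the restriction of $E$ to $B$. A Borel set $B\subset X$ is full for $E$ if $B$ meets every $E$-class. For $E\subset F$ on $X$, $F$ is smooth over $E$ if there is a Borel homomorphism $f\colon F\to E$ such that $x\mathrel{F}f(x)$ for all $x\in X$. For a standard Borel space $Z$, $E_{\mathsf{set}}(Z)$ is the equivalence relation on $Z^\omega$ given by $\langle z_n\rangle\mathrel{E_{\mathsf{set}}(Z)}\langle z_n'\rangle$ iff $\{z_n:n\in\omega\}=\{z'_n:n\in\omega\}$. For $Z$ a subset of $2^\omega$ or $\omega^\omega$, $E_0(Z)$ is eventual equality (agreement at all but finitely many coordinates) on $Z$. A relation is a triple $\mathbf{A}=(A_-,A_+,A)$ with $A\subset A_-\times A_+$. It is invariant if each of $A_-$, $A_+$ is a Borel subset of $2^\omega$ or of $\omega^\omega$, and whenever $x\mathrel{E_0(A_-)}x'$ and $y\mathrel{E_0(A_+)}y'$ we have $x\mathrel{A}y\iff x'\mathrel{A}y'$. A countable Borel equivalence relation $E$ on $X$ is Borel non-$(\mathbf{A},\Phi)$ if for every Borel homomorphism $\phi\colon E\to E_{\mathsf{set}}(A_+)$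 such that the family $\{\phi(x)(n):n\in\omega\}$ has property $\Phi$ for each $x\in X$, there exists a Borel homomorphism $\psi\colon E\to E_0(A_-)$ such that for all $x\in X$ and $n\in\omega$, $\neg(\psi(x)\mathrel{A}\phi(x)(n))$. *)

(* Defs.v *)
From HB Require Import structures.
From mathcomp Require Import all_boot all_order all_algebra.
From mathcomp Require Import all_classical all_reals all_analysis.
From Corelib Require Export RelationClasses Relation_Definitions.

Set Implicit Arguments.
Unset Strict Implicit.
Unset Printing Implicit Defensive.

Local Open Scope classical_set_scope.

(* [measurableType] is not used because its carriers are pointed: the
   restriction of an equivalence relation to an empty Borel set, or an empty
   [A_-] or [A_+], has to be allowed. *)
Record borelSpace := BorelSpace {
  carrier :> Type;
  borel : set (set carrier);
  borel_sigma_algebra : sigma_algebra [set: carrier] borel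
}.

Definition borel_fun (X Y : borelSpace) (f : X -> Y) : Prop :=
  forall B : set Y, borel B -> borel (f @^-1` B).

Definition generated (T : Type) (G : set (set T)) : borelSpace :=
  @BorelSpace T <<s G >> (smallest_sigma_algebra [set: T] G).

Definition borel_of (T : topologicalType) : borelSpace := generated (@open T).

Definition subspace_of (X : borelSpace) (B : set X) : borelSpace :=
  @BorelSpace (set_type B) (preimage_set_system setT set_val (@borel X))
    (sigma_algebra_preimage setT set_val (borel_sigma_algebra X)).

Definition prod_space (X Y : borelSpace) : borelSpace :=
  generated [set A `*` B | A in @borel X & B in @borel Y].

(* Z^omega, with the product sigma-algebra *)
Definition power_space (Z : borelSpace) : borelSpace :=
  generated [set [set z : nat -> Z | B (z n)] | n in [set: nat] & B in @borel Z].

(* [completeType] is pointed, hence the existential limit in place of [cvg]. *)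
Definition polish (R : realType) (M : metricType R) : Prop :=
  (forall F : set_system M, ProperFilter F -> cauchy F -> exists x : M, F --> x)
  /\ (exists D : set M, countable D /\ dense D).

Definition standard_borel (R : realType) (X : borelSpace) : Prop :=
  exists (M : metricType R) (h : X -> borel_of M),
    [/\ polish M, bijective h & forall B, borel (h @^-1` B) <-> borel B].

Definition countable_borel_equivalence (X : borelSpace) (E : relation X) : Prop :=
  [/\ Equivalence E,
      @borel (prod_space X X) [set p | E p.1 p.2] &
      forall x, countable [set y | E x y]].

Definition borel_hom (X Y : borelSpace) (E : relation X) (F : relation Y)
    (f : X -> Y) : Prop :=
  borel_fun f /\ forall x x', E x x' -> F (f x) (f x').

Definition borel_reducible (X Y : borelSpace) (E : relation X) (F : relation Y) :
    Prop :=
  exists f : X -> Y, borel_fun f /\ forall x x', E x x' <-> F (f x) (f x').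

Definition restriction (X : borelSpace) (E : relation X) (B : set X) :
    relation (subspace_of B) :=
  fun x y => E (set_val x) (set_val y).

Arguments restriction {X} E B x y.

Definition full_for (X : borelSpace) (E : relation X) (B : set X) : Prop :=
  forall x, exists2 y, B y & E x y.

Definition subrel_of (X : Type) (E F : relation X) : Prop :=
  forall x y, E x y -> F x y.

Definition smooth_over (X : borelSpace) (F E : relation X) : Prop :=
  exists f : X -> X, borel_hom F E f /\ forall x, F x (f x).

Definition E_set (Z : borelSpace) : relation (power_space Z) :=
  fun z z' => range z = range z'.

Arguments E_set Z z z' : clear implicits.

Inductive alphabet := Two | Omega.

(* both alphabets carry the discrete topology *)
Definition letter (a : alphabet) : topologicalType :=
  match a with Two => bool | Omega => nat end.

(* 2^omega and omega^omega *)
Definition sequences (a : alphabet) : borelSpace :=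
  borel_of (prod_topology (fun _ : nat => letter a)).

Definition E_0 (a : alphabet) (Z : set (sequences a)) :
    relation (subspace_of Z) :=
  fun x x' => \forall n \near \oo, set_val x n = set_val x' n.

Arguments E_0 {a} Z x x'.

Record invariant_relation := InvariantRelation {
  alphabet_minus : alphabet;
  alphabet_plus : alphabet;
  minus_set : set (sequences alphabet_minus);
  plus_set : set (sequences alphabet_plus);
  minus_borel : borel minus_set;
  plus_borel : borel plus_set;
  related : subspace_of minus_set -> subspace_of plus_set -> Prop;
  related_invariant : forall x x' y y',
    E_0 minus_set x x' -> E_0 plus_set y y' -> (related x y <-> related x' y')
}.

Arguments minus_set : clear implicits.
Arguments plus_set : clear implicits.
Arguments minus_borel : clear implicits.
Arguments plus_borel : clear implicits.
Arguments related : clear implicits.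

Notation "A .-minus" := (subspace_of (minus_set A))
  (at level 2, format "A .-minus") : type_scope.
Notation "A .-plus" := (subspace_of (plus_set A))
  (at level 2, format "A .-plus") : type_scope.

Definition borel_non (A : invariant_relation) (Phi : set (set A.-plus))
    (X : borelSpace) (E : relation X) : Prop :=
  forall phi : X -> power_space A.-plus,
    borel_hom E (E_set A.-plus) phi ->
    (forall x, Phi (range (phi x))) ->
    exists2 psi : X -> A.-minus,
      borel_hom E (E_0 (minus_set A)) psi &
      forall x n, ~ related A (psi x) (phi x n).

(* [G !=set0]: the families [range (phi x)] above are never empty, so [Phi]
   is not required to hold of the empty union. *)
Definition closed_under_unions (T : Type) (Phi : set (set T)) : Prop :=
  forall G : set (set T), G !=set0 -> G `<=` Phi -> Phi (\bigcup_(S in G) S).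

(* Main.v *)
Require Import Defs.
From mathcomp Require Import all_boot all_order all_algebra.
From mathcomp Require Import all_classical all_reals all_analysis.
From mathcomp Require Import zify.

(** Parts (i) to (iv) are one argument. Suppose that [i : Z -> X] and
[r : X -> Z] are Borel homomorphisms from [G] to [E] and from [E] to [G], and
that [r (i z)] always lies in the [G]-class of [z]. Given [phi] on [Z], apply the
hypothesis on [E] to [phi \o r] and compose the resulting [psi] with [i]: this
works for [phi], because [phi] has the same range at [z] as at [r (i z)]. That is
[borel_non_transfer]. In (iv), [i] witnesses smoothness and [r] is the
identity. In (iii), [r] is the inclusion of [B] and [i] moves every point into
[B] along its class. In (i) these two maps exchange their roles, after the points
whose class misses [B] have been sent to a fixed point of [B]. In (ii), [i] is
the reduction and [r] chooses, for [y] in the saturation of its image, some [x]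
with [F y (i x)]. For (v), list the union of the ranges of [phi] over an
[F']-class as a single sequence: it has the property by closure under
unions, and a [psi] that avoids it avoids every [phi x n].

The maps into [B] and back along the reduction, and the Borel enumeration of
the classes behind (v), come from the Lusin-Novikov theorem
[lusin_novikov]: a Borel set [P] in [X * Y] with countable sections is
covered by the graphs of countably many Borel functions [g n], defined on the
whole of [X]. Totality makes the projection of [P] visibly Borel, as the union
over [n] of the sets of [x] with [P (x, g n x)].

Every nonempty standard Borel space is a Borel retract of the Cantor space: code
a point by the balls of a countable basis that contain it, and decode a
sequence by following the first small balls that it names, if these are
consistent. So [P] may be taken in the square of the Cantor space, where it is
analytic: [P] is the image of a closed set [F] of sequences of naturals under a
continuous [f]. Now consider finite lists of cones (basic clopen sets) in [F].
A list is alive for a countable family [g] of Borel functions if some [x] is the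
first coordinate of a point of the image of every cone of the list that lies on
no graph [g n]; it is killable if it is dead for some [g]. There are countably
many lists, so a single [g] kills all the killable ones
([killable_uniform]). If the list consisting of the whole space is killable,
its [g] covers [P]. If not, any cone in an unkillable list can be split into two
small cones with disjoint second projections so that the list stays unkillable
([unkillable_split]): otherwise, for this uniform [g], the part of the
image of that cone which lies off the graphs and over the [x] witnessing life
is the graph of a partial function. It is analytic, so it extends to a total
Borel function by Lusin's separation theorem ([analytic_graph]), and adding this
function to [g] would kill the list. Iterating the splitting gives a Cantor
scheme whose branches all have the same first coordinate and have distinct
second coordinates ([cantor_scheme]), so that [P] has an uncountable section. *)

Set Implicit Arguments.
Unset Strict Implicit.
Unset Printing Implicit Defensive.

Import Order.TTheory GRing.Theory Num.Theory.

Local Open Scope classical_set_scope.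

(** * Borel sets and Borel functions *)

Section BorelSets.
Context (T : borelSpace).
Implicit Types (A B : set T).

Lemma eq_borel A B : (forall x, A x <-> B x) -> borel A -> borel B.
Proof. by move=> AB; rewrite (_ : A = B)//; apply/seteqP; split=> x /AB. Qed.

Lemma borel_not A : borel A -> borel [set x | ~ A x].
Proof.
case: (borel_sigma_algebra T) => _ BC _ /BC.
by rewrite setTD.
Qed.

Lemma borel_ex (I : countType) (A : I -> set T) :
  (forall i, borel (A i)) -> borel [set x | exists i, A i x].
Proof.
move=> bA; case: (borel_sigma_algebra T) => B0 _ BU.
rewrite (_ : [set x | _] =
    \bigcup_n if unpickle n is Some i then A i else set0); last first.
  apply/seteqP; split=> [x [i Aix]|x [n _]].
    by exists (pickle i) => //; rewrite pickleK.
  by case: unpickle => // i Aix; exists i.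
by apply: BU => n; case: unpickle.
Qed.

Lemma borel_all (I : countType) (A : I -> set T) :
  (forall i, borel (A i)) -> borel [set x | forall i, A i x].
Proof.
move=> bA; apply: eq_borel (borel_not (borel_ex (fun i => borel_not (bA i)))).
move=> x /=; split; last by move=> Ax [i]; exact.
by move=> nA i; apply: contrapT => nAi; apply: nA; exists i.
Qed.

Lemma borel_and A B : borel A -> borel B -> borel [set x | A x /\ B x].
Proof.
move=> bA bB.
have /borel_all : forall b : bool, borel (if b then A else B) by case.
apply: eq_borel => x /=; split; last by move=> [? ?] [].
by move=> AB; split; [exact: (AB true)|exact: (AB false)].
Qed.

Lemma borel_imply A B : borel A -> borel B -> borel [set x | A x -> B x].
Proof.
move=> bA bB; apply: eq_borel (borel_not (borel_and bA (borel_not bB))).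
move=> x /=; split; last by move=> AB [/AB].
by move=> nAB Ax; apply: contrapT => nBx; exact: nAB.
Qed.

Lemma borel_or A B : borel A -> borel B -> borel [set x | A x \/ B x].
Proof.
move=> bA bB; apply: eq_borel (borel_imply (borel_not bA) bB) => x /=.
by split=> [|[]//]; have [] := pselect (A x); tauto.
Qed.

Lemma borel_const (P : Prop) : borel [set _ : T | P].
Proof.
have b0 : @borel T set0 by case: (borel_sigma_algebra T).
have [p|np] := pselect P; last by apply: eq_borel b0.
by apply: eq_borel (borel_not b0) => x; split=> // _ [].
Qed.

End BorelSets.

Lemma generated_min (T : Type) (G S : set (set T)) (B : set T) :
  (forall C, G C -> S C) ->
  (forall C, S C -> S [set x | ~ C x]) ->
  (forall C : nat -> set T, (forall n, S (C n)) -> S [set x | exists n, C n x]) ->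
  S set0 -> @borel (generated G) B -> S B.
Proof.
move=> GS SC SU S0; apply; split=> //; split=> // [A /SC|A SA].
  by rewrite setTD.
have := SU _ SA; congr S; apply/seteqP; split=> x [n]; first by exists n.
by move=> _; exists n.
Qed.

Lemma borel_gen (T : Type) (G : set (set T)) (B : set T) :
  G B -> @borel (generated G) B.
Proof. exact: sub_sigma_algebra. Qed.

Lemma borel_fun_generated (X : borelSpace) (T : Type) (G : set (set T))
    (f : X -> generated G) :
  (forall B, G B -> borel (f @^-1` B)) -> borel_fun f.
Proof.
move=> fG B; apply: (@generated_min _ _ (fun B => borel (f @^-1` B))) => //.
- by move=> C /borel_not.
- by move=> C /borel_ex.
- exact: borel_const False.
Qed.

Lemma borel_fun_comp (X Y Z : borelSpace) (f : X -> Y) (g : Y -> Z) :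
  borel_fun f -> borel_fun g -> borel_fun (g \o f).
Proof. by move=> bf bg B /bg /bf. Qed.

Lemma borel_fun_id (X : borelSpace) : borel_fun (@id X).
Proof. by move=> B. Qed.

Lemma borel_fun_cst (X Y : borelSpace) (y : Y) : borel_fun (fun _ : X => y).
Proof. by move=> B _; exact: borel_const (B y). Qed.

Lemma borel_fun_if (X Y : borelSpace) (D : set X) (f g : X -> Y) :
  borel D -> borel_fun f -> borel_fun g ->
  borel_fun (fun x => if pselect (D x) then f x else g x).
Proof.
move=> bD bf bg B bB.
apply: eq_borel (borel_and (borel_imply bD (bf _ bB))
                           (borel_imply (borel_not bD) (bg _ bB))).
by move=> x /=; case: pselect => //= Dx; tauto.
Qed.

Lemma borel_fun_nat (X Y : borelSpace) (c : X -> nat) (f : nat -> X -> Y) :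
  (forall n, borel [set x | c x = n]) -> (forall n, borel_fun (f n)) ->
  borel_fun (fun x => f (c x) x).
Proof.
move=> bc bf B bB.
apply: eq_borel (borel_ex (fun n => borel_and (bc n) (bf n _ bB))).
by move=> x /=; split; [case=> n [->]|exists (c x)].
Qed.

Lemma borel_fun_pair (X Y Z : borelSpace) (f : X -> Y) (g : X -> Z) :
  borel_fun f -> borel_fun g ->
  @borel_fun X (prod_space Y Z) (fun x => (f x, g x)).
Proof.
move=> bf bg; apply: borel_fun_generated => _ [A bA [B bB <-]].
exact: borel_and (bf _ bA) (bg _ bB).
Qed.

Lemma borel_fun_fst (X Y : borelSpace) : @borel_fun (prod_space X Y) X fst.
Proof.
move=> A bA; apply: borel_gen.
exists A => //; exists setT; first exact: borel_const True.
by apply/seteqP; split=> x //= [].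
Qed.

Lemma borel_fun_snd (X Y : borelSpace) : @borel_fun (prod_space X Y) Y snd.
Proof.
move=> A bA; apply: borel_gen.
exists setT; first exact: borel_const True.
exists A => //.
by apply/seteqP; split=> x //= [].
Qed.

Lemma borel_fun_power (X Z : borelSpace) (f : X -> power_space Z) :
  (forall n, borel_fun (fun x => f x n)) -> borel_fun f.
Proof.
move=> bf; apply: borel_fun_generated => _ [n _ [B bB <-]].
exact: bf.
Qed.

Lemma borel_fun_coord (Z : borelSpace) (n : nat) :
  @borel_fun (power_space Z) Z (fun z => z n).
Proof. by move=> B bB; apply: borel_gen; exists n => //; exists B. Qed.

Lemma borel_fun_set_val (X : borelSpace) (B : set X) :
  @borel_fun (subspace_of B) X set_val.
Proof. by move=> C bC; exists C => //; rewrite setTI. Qed.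

Lemma borel_fun_subspace (X Y : borelSpace) (B : set Y)
    (f : X -> subspace_of B) :
  borel_fun (fun x => set_val (f x)) -> borel_fun f.
Proof. by move=> bf _ [C bC <-]; rewrite setTI; exact: bf. Qed.

(** Uniformization over [nat]: a Borel relation with values in [nat] is
uniformized by its least witness. *)
Lemma borel_least_index (X : borelSpace) (A : nat -> set X) :
  (forall n, borel (A n)) ->
  exists c : X -> nat, (forall n, borel [set x | c x = n]) /\
    forall x n, A n x -> A (c x) x.
Proof.
move=> bA.
have [c cP] : {c : X -> nat & forall x n, c x = n <->
    (A n x \/ ~ (exists m, A m x) /\ n = 0) /\ forall m, (m < n)%N -> ~ A m x}.
  apply: (@choice _ _ (fun x c => forall n, c = n <->
    (A n x \/ ~ (exists m, A m x) /\ n = 0) /\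
    forall m, (m < n)%N -> ~ A m x)) => x.
  have [[n Anx]|nA] := pselect (exists n, A n x); last first.
    exists 0 => n; split=> [<-|[[Anx|[]//]]]; first by split=> //; right.
    by case: nA; exists n.
  have ex : exists n, `[<A n x>] by exists n; apply/asboolP.
  case: (ex_minnP ex) => m /asboolP Amx mmin; exists m => k.
  split=> [<-|[[Akx kmin|[[]]]]]; last by exists m.
    split=> [|j jm /asboolP/mmin]; first by left.
    by rewrite leqNgt jm.
  apply/eqP; rewrite eqn_leq mmin ?andTb; last exact/asboolP.
  by rewrite leqNgt; apply/negP => /kmin.
exists c; split=> [n|x n Anx]; last first.
  by have [[Acx //|[nA _]] _] := (cP x _).1 erefl; case: nA; exists n.
have below m : borel [set x | (m < n)%N -> ~ A m x].
  exact: borel_imply (borel_const _ _) (borel_not (bA m)).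
have none : borel [set x | ~ (exists m, A m x) /\ n = 0].
  exact: borel_and (borel_not (borel_ex bA)) (borel_const _ _).
apply: eq_borel (borel_and (borel_or (bA n) none) (borel_all below)).
by move=> x /=; rewrite cP.
Qed.

(** * Analytic subsets of the square of the Cantor space *)

Definition cantor : borelSpace :=
  generated [set [set x : nat -> bool | x k] | k in [set: nat]].

Lemma borel_coord k : @borel cantor [set x | x k].
Proof. by apply: borel_gen; exists k. Qed.

Lemma borel_fun_cantor (X : borelSpace) (f : X -> cantor) :
  (forall k, borel [set x | f x k]) -> borel_fun f.
Proof. by move=> bf; apply: borel_fun_generated => _ [k _ <-]; exact: bf. Qed.

Lemma borel_neq (X : borelSpace) (f g : X -> cantor) :
  borel_fun f -> borel_fun g -> borel [set x | f x <> g x].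
Proof.
move=> bf bg.
have bk (h : X -> cantor) k : borel_fun h -> borel [set x | h x k].
  by move=> bh; exact: (bh _ (borel_coord k)).
have bE k : borel [set x | ~ ((f x k -> g x k) /\ (g x k -> f x k))].
  apply: borel_not; apply: borel_and.
    exact: borel_imply (bk f k bf) (bk g k bg).
  exact: borel_imply (bk g k bg) (bk f k bf).
apply: eq_borel (borel_ex bE) => x /=; split=> [[k nfg] fg|fg].
  by apply: nfg; rewrite fg.
apply: contrapT => nk; apply: fg; apply/funext => k.
apply: contrapT => nfg; apply: nk; exists k => -[fg gf].
by apply: nfg; apply/idP/idP.
Qed.

Definition agree n (a b : nat -> nat) := forall k, (k < n)%N -> a k = b k.

Lemma agree_le m n a b : (m <= n)%N -> agree n a b -> agree m a b.
Proof. by move=> mn ab k km; apply: ab; exact: leq_trans km mn. Qed.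

Lemma agree_sym n a b : agree n a b -> agree n b a.
Proof. by move=> ab k /ab. Qed.

Lemma agree_comp (e : nat -> nat) n :
  exists m, forall a b, agree m a b -> agree n (a \o e) (b \o e).
Proof.
exists (\max_(k < n) (e k).+1)%N => a b ab k kn; apply: ab.
exact: (leq_bigmax (F := fun k : 'I_n => (e k).+1) (Ordinal kn)).
Qed.

Definition baire_closed (F : set (nat -> nat)) :=
  forall a, (forall n, exists2 b, F b & agree n a b) -> F a.

Definition continuous_on (F : set (nat -> nat))
    (f : (nat -> nat) -> cantor * cantor) :=
  forall a k, F a -> exists n, forall b, F b -> agree n a b ->
    (f b).1 k = (f a).1 k /\ (f b).2 k = (f a).2 k.

(** Continuous images of closed subsets of the Baire space. A closed domain, in
place of the whole Baire space, includes the empty set and makes restriction to a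
cone and countable intersection immediate. *)
Definition analytic (S : set (cantor * cantor)) := exists F f,
  [/\ baire_closed F, continuous_on F f &
      forall w, S w <-> exists2 a, F a & f a = w].

Lemma baire_closed_comp (e : nat -> nat) F :
  baire_closed F -> baire_closed [set a : nat -> nat | F (a \o e)].
Proof.
move=> cF a aF; apply: cF => n; have [m em] := agree_comp e n.
by have [b Fb /em ab] := aF m; exists (b \o e).
Qed.

Lemma continuous_on_comp (e : nat -> nat) F f a k :
  continuous_on F f -> F (a \o e) -> exists n, forall b, F (b \o e) ->
    agree n a b ->
    (f (b \o e)).1 k = (f (a \o e)).1 k /\ (f (b \o e)).2 k = (f (a \o e)).2 k.
Proof.
move=> cf Fa; have [n fn] := cf _ k Fa; have [m em] := agree_comp e n.
by exists m => b Fb /em; exact: fn.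
Qed.

Lemma eq_analytic S T : (forall w, S w <-> T w) -> analytic S -> analytic T.
Proof.
move=> ST; rewrite (_ : S = T)//.
by apply/seteqP; split=> w /ST.
Qed.

(** The first entry of a sequence names the set of the union, and the tail is the
parameter there. *)
Lemma analytic_ex (S : nat -> set (cantor * cantor)) :
  (forall n, analytic (S n)) -> analytic [set w | exists n, S n w].
Proof.
move=> /choice[F /choice[f Ff]].
have cF n : baire_closed (F n) by have [] := Ff n.
have cf n : continuous_on (F n) (f n) by have [] := Ff n.
have Sf n w : S n w <-> exists2 a, F n a & f n a = w by have [] := Ff n.
exists [set a : nat -> nat | F (a 0) (a \o succn)],
  (fun a : nat -> nat => f (a 0) (a \o succn)); split.
- move=> a aF; apply: (baire_closed_comp (cF (a 0))) => n.
  have [b /= Fb ab] := aF n.+1; exists b; last exact: agree_le (leqnSn n) ab.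
  by rewrite /= ab.
- move=> a k Fa; have [n fn] := continuous_on_comp k (cf (a 0)) Fa.
  exists n.+1 => b /= Fb ab; have a0 : a 0 = b 0 by exact: ab.
  by rewrite -a0 in Fb *; apply: fn => //; exact: agree_le (leqnSn n) ab.
- move=> w; split=> [[n /Sf[a Fa <-]]|[a Fa <-]]; last first.
    by exists (a 0); apply/Sf; exists (a \o succn).
  exists (fun k => if k is k'.+1 then a k' else n) => //=.
Qed.

(** A sequence is read as countably many sequences, its columns, through the
injective numbering of pairs. *)
Definition column (n k : nat) : nat := pickle (n, k).

Lemma merge_columns (a : nat -> nat -> nat) :
  exists b : nat -> nat, forall n, b \o column n = a n.
Proof.
exists (fun p => if unpickle p is Some (n, k) then a n k else 0) => n.
by apply/funext => k; rewrite /= /column pickleK.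
Qed.

(** A parameter for the intersection packs one parameter for each set in its
columns. Requiring them to have the same image is a closed condition, as the [f n]
are continuous into a Hausdorff space. *)
Lemma analytic_all (S : nat -> set (cantor * cantor)) :
  (forall n, analytic (S n)) -> analytic [set w | forall n, S n w].
Proof.
move=> /choice[F /choice[f Ff]].
have cF n : baire_closed (F n) by have [] := Ff n.
have cf n : continuous_on (F n) (f n) by have [] := Ff n.
have Sf n w : S n w <-> exists2 a, F n a & f n a = w by have [] := Ff n.
pose G := [set a : nat -> nat | forall n, F n (a \o column n) /\
  f n (a \o column n) = f 0 (a \o column 0)].
exists G, (fun a : nat -> nat => f 0 (a \o column 0)); split.
- move=> a aG.
  have Fa n : F n (a \o column n).
    apply: (baire_closed_comp (cF n)) => m.
    by have [b Gb ab] := aG m; exists b => //; case: (Gb n).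
  move=> n; split=> //.
  have fE k : (f n (a \o column n)).1 k = (f 0 (a \o column 0)).1 k /\
              (f n (a \o column n)).2 k = (f 0 (a \o column 0)).2 k.
    have [p fp] := continuous_on_comp k (cf n) (Fa n).
    have [q fq] := continuous_on_comp k (cf 0) (Fa 0).
    have [b Gb ab] := aG (maxn p q).
    have [] := fp b (Gb n).1 (agree_le (leq_maxl p q) ab).
    have [] := fq b (Gb 0).1 (agree_le (leq_maxr p q) ab).
    by rewrite (Gb n).2 => <- <- <- <-.
  rewrite [LHS]surjective_pairing [RHS]surjective_pairing.
  by congr (_, _); apply/funext => k; case: (fE k).
- move=> a k Ga; have [n fn] := continuous_on_comp k (cf 0) (Ga 0).1.
  by exists n => b Gb; apply: fn; case: (Gb 0).
- move=> w; split=> [Sw|[a Ga <-] n]; last first.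
    by apply/Sf; exists (a \o column n); [case: (Ga n)|case: (Ga n)].
  have /choice[a aP] : forall n, exists a, F n a /\ f n a = w.
    by move=> n; have /Sf[a Fa fa] := Sw n; exists a.
  have [b bE] := merge_columns a; exists b; last by rewrite bE; case: (aP 0).
  by move=> n; rewrite !bE; have [Fa ->] := aP n; have [_ ->] := aP 0.
Qed.

Lemma analytic_and S T :
  analytic S -> analytic T -> analytic [set w | S w /\ T w].
Proof.
move=> aS aT.
have : analytic [set w | forall n, (if n is 0 then S else T) w].
  by apply: analytic_all => -[].
apply: eq_analytic => w /=; split=> [ST|[Sw Tw] []//].
by split; [exact: ST 0|exact: ST 1].
Qed.

Definition bits (a : nat -> nat) : cantor := fun k => a k == 0.

Lemma bits_surjective (x : cantor) : exists a, bits a = x.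
Proof.
exists (fun k => ~~ x k : nat); apply/funext => k.
by rewrite /bits; case: (x k).
Qed.

Definition decode (a : nat -> nat) : cantor * cantor :=
  (bits (a \o column 0), bits (a \o column 1)).

Lemma decode_surjective w : exists a, decode a = w.
Proof.
case: w => x y; have [a <-] := bits_surjective x; have [b <-] := bits_surjective y.
have [c cE] := merge_columns (fun n => if n is 0 then a else b).
by exists c; rewrite /decode !cE.
Qed.

(** [decode] is a continuous surjection, and the preimage of [S] under it is
clopen. *)
Lemma analytic_clopen (S : set (cantor * cantor)) n :
  (forall a b, agree n a b -> S (decode a) -> S (decode b)) -> analytic S.
Proof.
move=> Sn; exists [set a | S (decode a)], decode; split.
- by move=> a /(_ n)[b Sb /agree_sym ab]; exact: Sn ab Sb.
- move=> a k _; exists (maxn (column 0 k).+1 (column 1 k).+1) => b _ ab.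
  by rewrite /decode/bits/= !ab ?leq_maxl ?leq_maxr.
- move=> w; split=> [|[a ? <-]//].
  by have [a <-] := decode_surjective w; exists a.
Qed.

(** The sets that are analytic together with their complement form a
sigma-algebra, and it contains the rectangles. *)
Lemma analytic_borel (P : set (cantor * cantor)) :
  @borel (prod_space cantor cantor) P -> analytic P.
Proof.
move=> bP; pose bianalytic (Q : set (cantor * cantor)) :=
  analytic Q /\ analytic [set w | ~ Q w].
have bi_clopen Q n :
    (forall a b, agree n a b -> Q (decode a) <-> Q (decode b)) -> bianalytic Q.
  move=> Qn; split; apply: (@analytic_clopen _ n) => a b ab;
    have := Qn _ _ ab => /=; tauto.
have bi_not Q : bianalytic Q -> bianalytic [set w | ~ Q w].
  move=> [aQ aQ']; split; first by [].
  apply: eq_analytic aQ => w /=.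
  by split=> [Qw nQ|/contrapT//]; exact: nQ.
have bi_ex (Q : nat -> set _) :
    (forall n, bianalytic (Q n)) -> bianalytic [set w | exists n, Q n w].
  move=> bQ; split; first by apply: analytic_ex => n; case: (bQ n).
  apply: eq_analytic (analytic_all (fun n => (bQ n).2)) => w /=.
  by split=> [nQ [n]|nQ n Qn]; [exact: nQ|apply: nQ; exists n].
have bi0 : bianalytic set0 by exact: (bi_clopen _ 0).
suff [] : bianalytic P by [].
apply: (@generated_min _ _ bianalytic P _ bi_not bi_ex bi0 bP).
move=> _ [A bA [B bB <-]].
have bi_fst : bianalytic [set w | A w.1].
  apply: (@generated_min _ _ (fun A => bianalytic [set w | A w.1])) bA => //.
  - move=> _ [k _ <-]; apply: (bi_clopen _ (column 0 k).+1) => a b ab.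
    by rewrite /decode/bits/= ab.
  - by move=> C; exact: bi_not.
  - by move=> C; exact: bi_ex.
have bi_snd : bianalytic [set w | B w.2].
  apply: (@generated_min _ _ (fun B => bianalytic [set w | B w.2])) bB => //.
  - move=> _ [k _ <-]; apply: (bi_clopen _ (column 1 k).+1) => a b ab.
    by rewrite /decode/bits/= ab.
  - by move=> C; exact: bi_not.
  - by move=> C; exact: bi_ex.
split; first exact: analytic_and bi_fst.1 bi_snd.1.
pose C n : set (cantor * cantor) :=
  if n is 0 then [set w | ~ A w.1] else [set w | ~ B w.2].
have aC n : analytic (C n) by case: n => [|n]; [exact: bi_fst.2|exact: bi_snd.2].
apply: eq_analytic (analytic_ex aC) => w /=.
split=> [[[|n] nC [Aw Bw]]|nAB]; [exact: nC|exact: nC|].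
have [Aw|nA] := pselect (A w.1); last by exists 0.
by exists 1 => Bw; apply: nAB.
Qed.

(** The projection to the first factor, kept inside the square: a new second
coordinate is read off a fresh column. *)
Lemma analytic_cylinder S :
  analytic S -> analytic [set w | exists y, S (w.1, y)].
Proof.
move=> [F [f [cF cf Sf]]].
exists [set a : nat -> nat | F (a \o column 0)],
  (fun a : nat -> nat => ((f (a \o column 0)).1, bits (a \o column 1))); split.
- exact: baire_closed_comp.
- move=> a k Fa; have [n fn] := continuous_on_comp k cf Fa.
  exists (maxn n (column 1 k).+1) => b Fb ab; split=> /=.
    by have [] := fn b Fb (agree_le (leq_maxl _ _) ab).
  by rewrite /bits/= ab// leq_maxr.
- move=> [x y]; split=> [[y' /Sf[a Fa fa]]|[a Fa [<- _]]]; last first.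
    exists (f (a \o column 0)).2; apply/Sf; exists (a \o column 0) => //.
    exact: surjective_pairing.
  have [b by_] := bits_surjective y.
  have [c cE] := merge_columns (fun n => if n is 0 then a else b).
  by exists c; rewrite /= !cE ?by_ ?fa.
Qed.

Definition cone (s : seq nat) : set (nat -> nat) :=
  [set a | forall k, (k < size s)%N -> a k = nth 0 s k].

Lemma cone_mkseq a n b : cone (mkseq a n) b <-> agree n a b.
Proof.
rewrite /cone/= size_mkseq; split=> ab k kn.
  by rewrite ab// nth_mkseq.
by rewrite nth_mkseq// ab.
Qed.

Lemma analytic_cone F f s : baire_closed F -> continuous_on F f ->
  analytic [set w | exists a, [/\ F a, cone s a & f a = w]].
Proof.
move=> cF cf; exists [set a | F a /\ cone s a], f; split.
- move=> a aF; split=> [|k ks].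
    by apply: cF => n; have [b [Fb _] ab] := aF n; exists b.
  by have [b [_ sb] ab] := aF (size s); rewrite ab// sb.
- by move=> a k [Fa _]; have [n fn] := cf a k Fa; exists n => b [Fb _]; exact: fn.
- by move=> w; split=> [[a [Fa sa fa]]|[a [Fa sa] fa]]; exists a.
Qed.

(** Lusin's theorem, for the first projections of [S] and [T]. If the images of
two cones cannot be separated, then neither can those of some pair of
immediate subcones. Following such pairs leads to parameters [a] and [b] whose
images differ in some coordinate [k] of the first projection; by continuity
the value of that coordinate separates the images of small cones around [a] and
[b], a contradiction. *)
Lemma lusin_separation S T : analytic S -> analytic T ->
  (forall x y y', S (x, y) -> ~ T (x, y')) ->
  exists B : set cantor,
    [/\ borel B, forall w, S w -> B w.1 & forall w, T w -> ~ B w.1].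
Proof.
move=> [F [f [cF cf Sf]]] [G [g [cG cg Tg]]] ST.
pose sep s t := exists B : set cantor, [/\ borel B,
  forall a, F a -> cone s a -> B (f a).1 &
  forall b, G b -> cone t b -> ~ B (g b).1].
suff [B [bB FB GB]] : sep [::] [::].
  exists B; split=> // w.
    by move=> /Sf[a Fa <-]; exact: FB.
  by move=> /Tg[a Fa <-]; exact: GB.
apply: contrapT => nsep0.
have cone_rcons s a : cone s a -> cone (rcons s (a (size s))) a.
  move=> sa k; rewrite size_rcons ltnS leq_eqVlt nth_rcons.
  by case: ltngtP => //= [/sa //|->].
have split_sep s t : (forall i j, sep (rcons s i) (rcons t j)) -> sep s t.
  move=> ij_sep; have B_ i := choice (ij_sep i).
  pose B i := projT1 (B_ i); have BP i j := projT2 (B_ i) j.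
  exists [set x | exists i, forall j, B i j x]; split.
  - by apply: borel_ex => i; apply: borel_all => j; have [] := BP i j.
  - move=> a Fa sa; exists (a (size s)) => j.
    by have [_ + _] := BP (a (size s)) j; apply=> //; exact: cone_rcons.
  - move=> b Gb tb [i /(_ (b (size t)))].
    by have [_ _] := BP i (b (size t)); apply=> //; exact: cone_rcons.
have /choice[next nextP] : forall st : seq nat * seq nat, exists ij : nat * nat,
    ~ sep st.1 st.2 -> ~ sep (rcons st.1 ij.1) (rcons st.2 ij.2).
  move=> [s t]; apply: contrapT => nij; apply: (nij); exists (0, 0) => nst.
  exfalso; apply: nst; apply: split_sep => i j; apply: contrapT => nsep.
  by apply: nij; exists (i, j).
pose u := fix u n := if n is m.+1 then
  (rcons (u m).1 (next (u m)).1, rcons (u m).2 (next (u m)).2)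
  else ([::], [::]) : seq nat * seq nat.
pose a n := (next (u n)).1; pose b n := (next (u n)).2.
have uE n : u n = (mkseq a n, mkseq b n).
  elim: n => //= n IH; rewrite !mkseqS.
  by congr (rcons _ _, rcons _ _); rewrite IH.
have nsep n : ~ sep (mkseq a n) (mkseq b n).
  suff : ~ sep (u n).1 (u n).2 by rewrite uE.
  by elim: n => //= n /nextP.
have Fa : F a.
  apply: cF => n; apply: contrapT => nF; apply: (nsep n); exists set0; split=> //.
  - exact: borel_const False.
  - by move=> a' Fa' /cone_mkseq aa'; apply: nF; exists a'.
  - by move=> b' _ _ [].
have Gb : G b.
  apply: cG => n; apply: contrapT => nG; apply: (nsep n); exists setT; split=> //.
  - exact: borel_const True.
  - by move=> b' Gb' /cone_mkseq bb'; case: nG; exists b'.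
have [k kP] : exists k, (f a).1 k <> (g b).1 k.
  apply: contrapT => nk; apply: (ST (f a).1 (f a).2 (g b).2).
    by apply/Sf; exists a => //; exact: surjective_pairing.
  apply/Tg; exists b => //; rewrite [LHS]surjective_pairing; congr (_, _).
  by apply/funext => k; apply: contrapT => nE; apply: nk; exists k; exact: nesym.
have [m fm] := cf a k Fa; have [n gn] := cg b k Gb.
apply: (nsep (maxn m n)); exists [set x | x k = (f a).1 k]; split.
- case: ((f a).1 k); first exact: borel_coord.
  apply: eq_borel (borel_not (borel_coord k)) => x /=.
  by split=> [/negP/negbTE|->].
- move=> a' Fa' /cone_mkseq/(agree_le (leq_maxl m n)) aa'.
  by have [] := fm a' Fa' aa'.
- move=> b' Gb' /cone_mkseq/(agree_le (leq_maxr m n)) bb' /=.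
  by have [-> _] := gn b' Gb' bb'; exact: nesym.
Qed.

(** For each [k], the sets of [x] at which the partial function takes values [y]
with [y k] true, respectively false, are disjoint projections of analytic
sets. A Borel set that separates them decides the [k]-th bit of the extension
everywhere. *)
Lemma analytic_graph S : analytic S ->
  (forall x y y', S (x, y) -> S (x, y') -> y = y') ->
  exists2 g : cantor -> cantor, borel_fun g & forall x y, S (x, y) -> y = g x.
Proof.
move=> aS uS.
have half k (b : bool) : analytic [set w | S w /\ w.2 k = b].
  apply: analytic_and aS _; apply: (@analytic_clopen _ (column 1 k).+1) => c d cd.
  by rewrite /decode/bits/= cd.
have /choice[B BP] : forall k, exists B : set cantor, [/\ borel B,
    forall w, S w /\ w.2 k = true -> B w.1 &
    forall w, S w /\ w.2 k = false -> ~ B w.1].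
  move=> k; apply: lusin_separation (half k true) (half k false) _.
  by move=> x y y' [Sy /= yk] [Sy' /=]; rewrite -(uS _ _ _ Sy Sy') yk.
exists (fun x k => `[<B k x>]).
  apply: borel_fun_cantor => k; have [bB _ _] := BP k.
  by apply: eq_borel bB => x; split=> /asboolP.
move=> x y Sxy; apply/funext => k; have [_ B1 B0] := BP k.
apply/esym; case yk: (y k); first by apply/asboolP; exact: (B1 (x, y)).
by apply/asboolP; exact: (B0 (x, y)).
Qed.

(** * Borel sets with countable sections in the Cantor space *)

Lemma no_injection_cantor_nat (h : (nat -> bool) -> nat) : ~ injective h.
Proof.
move=> hI; pose D k := `[<exists2 b, h b = k & b k = false>].
case hD : (D (h D)); last first.
  by move/asboolPn: (hD) => []; exists D.
by have /asboolP[b /hI bD] := hD; rewrite bD hD.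
Qed.

Definition fiber_meets (F : set (nat -> nat)) (f : (nat -> nat) -> cantor * cantor)
    (g : nat -> cantor -> cantor) (x : cantor) (s : seq nat) :=
  exists a, [/\ F a, cone s a, (f a).1 = x & forall n, (f a).2 <> g n x].

Definition alive F f g (l : seq (seq nat)) :=
  exists x, forall s, s \in l -> fiber_meets F f g x s.

(** Killable lists are to be thought of as negligible: countably many Borel
graphs can be removed so that no fiber meets all the cones of the list. *)
Definition killable F f l :=
  exists2 g : nat -> cantor -> cantor,
    (forall n, borel_fun (g n)) & ~ alive F f g l.

Definition separated (F : set (nat -> nat)) (f : (nat -> nat) -> cantor * cantor)
    (s t : seq nat) :=
  forall a b, F a -> F b -> cone s a -> cone t b -> (f a).2 <> (f b).2.

Definition extends (s t : seq nat) :=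
  (size s <= size t)%N /\ forall k, (k < size s)%N -> nth 0 t k = nth 0 s k.

Definition splits F f n (s t t' : seq nat) :=
  [/\ extends s t, extends s t', (n <= size t)%N, (n <= size t')%N &
      separated F f t t'].

Lemma analytic_fiber_meets F f (g : nat -> cantor -> cantor) s :
  baire_closed F -> continuous_on F f -> (forall n, borel_fun (g n)) ->
  analytic [set w | exists a,
    [/\ F a, cone s a, f a = w & forall n, w.2 <> g n w.1]].
Proof.
move=> cF cf bg.
have bneq : @borel (prod_space cantor cantor) [set w | forall n, w.2 <> g n w.1].
  apply: borel_all => n.
  apply: (@borel_neq (prod_space cantor cantor) snd (g n \o fst)).
    exact: borel_fun_snd.
  exact: (borel_fun_comp (@borel_fun_fst cantor cantor) (bg n)).
apply: eq_analytic (analytic_and (analytic_cone s cF cf) (analytic_borel bneq)).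
move=> w; split=> [[[a [Fa sa fa]] nw]|[a [Fa sa fa nw]]]; first by exists a.
by split=> //; exists a.
Qed.

Lemma analytic_alive F f (g : nat -> cantor -> cantor) (l : seq (seq nat)) :
  baire_closed F -> continuous_on F f -> (forall n, borel_fun (g n)) ->
  analytic [set w | forall s, s \in l -> fiber_meets F f g w.1 s].
Proof.
move=> cF cf bg; elim: l => [|s l IH].
  by apply: (@analytic_clopen _ 0).
have as_ := analytic_cylinder (analytic_fiber_meets s cF cf bg).
apply: eq_analytic (analytic_and as_ IH) => w /=; split.
  move=> [[y [a [Fa sa fa nw]]] lw] t; rewrite inE => /predU1P[->|]; last exact: lw.
  by exists a; split; rewrite ?fa.
move=> slw; split=> [|t tl]; last by apply: slw; rewrite inE tl orbT.
have [a [Fa sa fa nw]] := slw s (mem_head _ _).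
exists (f a).2, a; split=> //=; rewrite -fa//; exact: surjective_pairing.
Qed.

(** There are countably many lists, and enlarging the family [g] preserves
death. This replaces the transfinite derivation of the usual proof. *)
Lemma killable_uniform F f :
  exists2 g : nat -> cantor -> cantor, (forall n, borel_fun (g n)) &
  forall l, killable F f l -> ~ alive F f g l.
Proof.
have /choice[g gP] : forall l, exists g : nat -> cantor -> cantor,
    (forall n, borel_fun (g n)) /\ (killable F f l -> ~ alive F f g l).
  move=> l; have [[g bg ng]|nk] := pselect (killable F f l); first by exists g.
  by exists (fun _ => id); split=> // n; exact: borel_fun_id.
exists (fun k => if unpickle k is Some (l, n) then g l n else id) => [k|l kl].
  by case: unpickle => [[l n]|]; [case: (gP l)|exact: borel_fun_id].
have [_ /(_ kl) nal] := gP l; move=> [x lx]; apply: nal; exists x => s /lx.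
move=> [a [Fa sa fa nga]]; exists a; split=> // n.
by have := nga (pickle (l, n)); rewrite pickleK.
Qed.

(** Suppose that every such splitting were killable, hence dead for the uniform
family [g]. Over the points [x] at which [g] leaves the whole list alive, the cone
of [s] cannot contain two parameters with distinct values: short initial
segments of them would split it. So what remains there of its image is an
analytic graph. Adding a Borel extension of that graph to [g] kills the list. *)
Lemma unkillable_split F f n s l l' :
  baire_closed F -> continuous_on F f ->
  ~ killable F f (l ++ s :: l') ->
  exists t t', splits F f n s t t' /\ ~ killable F f (l ++ t :: t' :: l').
Proof.
move=> cF cf nk; apply: contrapT => nsplit; apply: nk.
have [g bg gP] := killable_uniform F f.
pose L := l ++ s :: l'.
pose S := [set w | (exists a,
    [/\ F a, cone s a, f a = w & forall n, w.2 <> g n w.1]) /\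
  forall t, t \in L -> fiber_meets F f g w.1 t].
have aS : analytic S.
  exact: analytic_and (analytic_fiber_meets s cF cf bg) (analytic_alive L cF cf bg).
have uS x y y' : S (x, y) -> S (x, y') -> y = y'.
  move=> [[a [Fa sa fa ga]] xL] [[b [Fb sb fb gb]] _].
  apply: contrapT => yy'; apply: nsplit.
  have [k kP] : exists k, y k <> y' k.
    apply: contrapT => nk; apply: yy'; apply/funext => k.
    by apply: contrapT => nE; apply: nk; exists k.
  have [p fp] := cf a k Fa; have [q fq] := cf b k Fb.
  pose m := maxn (maxn n (size s)) (maxn p q).
  have nm : (n <= m)%N by rewrite /m; lia.
  have sm : (size s <= m)%N by rewrite /m; lia.
  have pm : (p <= m)%N by rewrite /m; lia.
  have qm : (q <= m)%N by rewrite /m; lia.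
  have ext c : cone s c -> extends s (mkseq c m).
    move=> sc; split=> [|j js]; first by rewrite size_mkseq.
    by rewrite nth_mkseq ?sc//; exact: leq_trans js sm.
  exists (mkseq a m), (mkseq b m); split.
    split; rewrite ?size_mkseq//; [exact: ext|exact: ext|].
    move=> c d Fc Fd /cone_mkseq/(agree_le pm) ac /cone_mkseq/(agree_le qm) bd.
    have [_ cE] := fp c Fc ac; have [_ dE] := fq d Fd bd => cd.
    by apply: kP; move: cE dE; rewrite fa fb cd /= => <- <-.
  move=> /gP; apply; exists x => t.
  rewrite mem_cat !inE => /or4P[tl|/eqP->|/eqP->|tl].
  - by apply: xL; rewrite mem_cat tl.
  - by exists a; split; rewrite ?fa//; exact/cone_mkseq.
  - by exists b; split; rewrite ?fb//; exact/cone_mkseq.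
  - by apply: xL; rewrite mem_cat inE tl !orbT.
have [h bh hP] := analytic_graph aS uS.
(* [h] takes index 0, and the old family is shifted by one *)
exists (fun k => if k is k'.+1 then g k' else h) => [[|k]//|[x xL]].
have gL t : t \in L -> fiber_meets F f g x t.
  move=> /xL[a [Fa ta fa na]]; exists a; split=> // k; exact: (na k.+1).
have /xL[a [Fa sa fa na]] : s \in L by rewrite mem_cat inE eqxx orbT.
apply: (na 0); apply: hP; split; last exact: gL.
exists a; split=> //; first by rewrite -fa; exact: surjective_pairing.
by move=> k; exact: (na k.+1).
Qed.

Definition refines F f n (l l' : seq (seq nat)) := size l' = (size l).*2 /\
  forall i, (i < size l)%N ->
    splits F f n (nth [::] l i) (nth [::] l' i.*2) (nth [::] l' i.*2.+1).

(** The prefix [l0] holds the cones that are already split, so that the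
induction on [l] can treat the others one at a time. *)
Lemma unkillable_refine F f n l0 l :
  baire_closed F -> continuous_on F f -> ~ killable F f (l0 ++ l) ->
  exists l', refines F f n l l' /\ ~ killable F f (l0 ++ l').
Proof.
move=> cF cf; elim: l l0 => [|s l IH] l0 nk; first by exists [::].
have [t [t' [st nk']]] := unkillable_split n cF cf nk.
have [l' [[sl' ll'] nkl']] : exists l', refines F f n l l' /\
    ~ killable F f ((l0 ++ [:: t; t']) ++ l').
  by apply: IH; rewrite -catA.
exists (t :: t' :: l'); split; last by rewrite -catA in nkl'.
by split=> [|[|i] il //]; [rewrite /= sl'|exact: ll'].
Qed.

(** At stage [n.+1] the children of the [j]-th cone of the list [L n] are at the
places [j.*2] and [j.*2.+1] of [L n.+1], and a branch [b] follows the places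
[i b n]. Each list is alive, which provides one [x] for all of its cones; as
the cones shrink to the branches, continuity forces the first coordinates of all
branches to be equal. Two branches that part at stage [n] go to separated
siblings, which makes their second coordinates distinct. *)
Lemma cantor_scheme F f :
  baire_closed F -> continuous_on F f -> ~ killable F f [:: [::]] ->
  exists (x : cantor) (a : (nat -> bool) -> nat -> nat),
    [/\ forall b, F (a b), forall b, (f (a b)).1 = x &
        forall b c, (f (a b)).2 = (f (a c)).2 -> b = c].
Proof.
move=> cF cf nk0.
have /choice[next nextP] : forall nl : nat * seq (seq nat), exists l',
    ~ killable F f nl.2 -> refines F f nl.1.+1 nl.2 l' /\ ~ killable F f l'.
  move=> [n l]; have [nk|k] := pselect (killable F f l); first by exists [::].
  by have [l' ?] := @unkillable_refine F f n.+1 [::] l cF cf k; exists l'.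
pose L := fix L n := if n is m.+1 then next (m, L m) else [:: [::]].
have nkL n : ~ killable F f (L n) by elim: n => //= n /(nextP (n, L n))[].
have refL n : refines F f n.+1 (L n) (L n.+1).
  by have [] := nextP (n, L n) (nkL n).
pose i (b : nat -> bool) := fix i n := if n is m.+1 then ((i m).*2 + b m)%N else 0.
have iL b n : (i b n < size (L n))%N.
  by elim: n => //= n IH; have [-> _] := refL n; case: (b n); lia.
pose t b n := nth [::] (L n) (i b n).
have tL b n : t b n \in L n by exact: mem_nth.
have splitL b n : splits F f n.+1 (t b n)
    (nth [::] (L n.+1) (i b n).*2) (nth [::] (L n.+1) (i b n).*2.+1).
  by have [_] := refL n; apply.
have tS b n : extends (t b n) (t b n.+1) /\ (n < size (t b n.+1))%N.
  have [e e' se se' _] := splitL b n; rewrite /t/=.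
  by case: (b n); rewrite ?addn0 ?addn1.
have size_t b n : (n <= size (t b n))%N by case: n => // n; case: (tS b n).
have t_mono b m n : (m <= n)%N -> extends (t b m) (t b n).
  move=> /subnK <-; elim: (n - m)%N => [|k IH]; first by [].
  have [[st tE] _] := tS b (k + m)%N; have [st' tE'] := IH.
  split=> [|j js]; first exact: leq_trans st' st.
  by rewrite addSn tE ?tE'//; exact: leq_trans js st'.
pose a b k := nth 0 (t b k.+1) k.
have a_cone b n : cone (t b n) (a b).
  move=> j js; rewrite /a.
  have [nj|jn] := leqP n j.+1; last by have [_ ->] := t_mono b _ _ (ltnW jn).
  by have [_ ->] := t_mono b _ _ nj.
have [g bg gP] := killable_uniform F f.
have aliveL n : alive F f g (L n).
  by apply: contrapT => nal; apply: (nkL n); exists g.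
have meet b n : forall c, cone (t b n) c -> agree n (a b) c.
  move=> c tc k kn; have kt := leq_trans kn (size_t b n).
  by rewrite tc// (a_cone b n).
have Fa b : F (a b).
  apply: cF => n; have [x /(_ _ (tL b n))[c [Fc tc _ _]]] := aliveL n.
  by exists c => //; exact: meet.
have same b c : (f (a b)).1 = (f (a c)).1.
  apply/funext => k; have [p fp] := cf _ k (Fa b); have [q fq] := cf _ k (Fa c).
  have [x xL] := aliveL (maxn p q).
  have [b' [Fb' tb' fb' _]] := xL _ (tL b _).
  have [c' [Fc' tc' fc' _]] := xL _ (tL c _).
  have [<- _] := fp b' Fb' (agree_le (leq_maxl p q) (meet _ _ _ tb')).
  have [<- _] := fq c' Fc' (agree_le (leq_maxr p q) (meet _ _ _ tc')).
  by rewrite fb' fc'.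
exists (f (a (fun=> false))).1, a; split=> // b c fbc.
apply/funext => m; elim/ltn_ind: m => n IH.
have ibc : i b n = i c n.
  have below m : (m <= n)%N -> i b m = i c m.
    by elim: m => //= m IHm mn; rewrite IHm ?IH// ltnW.
  exact: below.
have [_ _ _ _ sep] := splitL b n.
have := a_cone b n.+1; have := a_cone c n.+1; rewrite {1 2}/t/= -ibc.
case: (b n); case: (c n) => //; rewrite ?addn0 ?addn1 => ac ab.
  by have := sep _ _ (Fa c) (Fa b) ac ab; rewrite fbc.
by have := sep _ _ (Fa b) (Fa c) ab ac; rewrite fbc.
Qed.

Lemma lusin_novikov_cantor (P : set (cantor * cantor)) :
  @borel (prod_space cantor cantor) P -> (forall x, countable [set y | P (x, y)]) ->
  exists2 g : nat -> cantor -> cantor, (forall n, borel_fun (g n)) &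
    forall x y, P (x, y) -> exists n, y = g n x.
Proof.
move=> bP cP; have [F [f [cF cf Pf]]] := analytic_borel bP.
have [[g bg ng]|nk] := pselect (killable F f [:: [::]]).
  exists g => // x y /Pf[a Fa fa]; apply: contrapT => ngxy; apply: ng.
  exists x => s; rewrite inE => /eqP ->; exists a; split; rewrite ?fa//.
  by move=> n yE; apply: ngxy; exists n.
have [x [a [Fa fax fa_inj]]] := cantor_scheme cF cf nk.
have /countable_injP[h hI] := cP x.
have Pa b : P (x, (f (a b)).2).
  by apply/Pf; exists (a b) => //; rewrite -(fax b); exact: surjective_pairing.
exfalso; apply: (@no_injection_cantor_nat (fun b => h (f (a b)).2)) => b c hbc.
by apply: fa_inj; apply: hI => //; rewrite inE; exact: Pa.
Qed.

(** * Passage to standard Borel spaces *)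

Section CantorRetract.
Context (R : realType) (M : metricType R).
Local Open Scope ring_scope.

Let r (n : nat) : R := n.+1%:R^-1.

Let r_gt0 n : 0 < r n. Proof. by rewrite invr_gt0. Qed.

Let r_small (e : R) : 0 < e -> exists N, forall n, (N <= n)%N -> r n < e.
Proof.
move=> e0; have [N _ NP] := near_infty_natSinv_lt (PosNum e0).
by exists N => n /NP.
Qed.

Let ball_eq (x y : M) : (forall e : R, 0 < e -> ball x e y) -> x = y.
Proof.
move=> xy; apply: mdist_positivity; apply/eqP; rewrite eq_le mdist_ge0 andbT.
apply/ler_addgt0Pl => e e0; rewrite addr0 ltW//.
by have := xy e e0; rewrite ballEmdist.
Qed.

(** Interiors of balls serve as the basic open sets. *)
Lemma dense_sequence (D : set M) (x0 : M) : countable D -> dense D ->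
  exists d : nat -> M, forall x (e : R), 0 < e -> exists i, (ball (d i) e)° x.
Proof.
move=> /countable_injP[h hI] dD.
have /choice[d dP] : forall n, exists p, forall q, D q -> h q = n -> q = p.
  move=> n; have [[p Dp <-]|np] := pselect (exists2 p, D p & h p = n).
    by exists p => q Dq; apply: hI; rewrite inE.
  by exists x0 => q Dq hq; case: np; exists q.
exists d => x e e0; have e20 : 0 < e / 2 by rewrite divr_gt0.
have [p [xp Dp]] : (ball x (e / 2))° `&` D !=set0.
  apply: dD; last exact: open_interior.
  by exists x; exact: nbhsx_ballx.
exists (h p); rewrite -(dP (h p) p Dp erefl).
apply: (filterS _ (nbhsx_ballx x _ e20)) => y xy.
rewrite [e]splitr; apply: ball_triangle xy.
by apply: ball_sym; exact: interior_subset xp.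
Qed.

Lemma cauchy_sequence_limit (u : nat -> M) : polish M ->
  (forall n m, ball (u n) (r n + r m) (u m)) ->
  exists y, forall n, ball (u n) (r n + r n) y.
Proof.
move=> [complM _] uC.
have [|y uy] := complM (u @ \oo) _.
  apply: cauchy_exP => e e0; have e20 : 0 < e / 2 by rewrite divr_gt0.
  have [N NP] := r_small e20; exists (u N).
  exists N => // n /= Nn; apply: le_ball (uC N n).
  by rewrite [leRHS]splitr lerD// ltW// NP.
exists y => n; have r20 : 0 < r n / 2 by rewrite divr_gt0.
have [N NP] := r_small r20.
have [K _ KP] : \forall m \near \oo, ball y (r n / 2) (u m).
  by apply: uy; exact: nbhsx_ballx.
pose m := maxn N K; have := KP m (leq_maxr _ _) => /ball_sym.
move=> /(ball_triangle (uC n m)); apply: le_ball.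
rewrite -addrA lerD2l [leRHS]splitr lerD2r ltW// NP//; exact: leq_maxl.
Qed.

(** The code of [y] records which basic balls contain it. [idx n c] is the first
ball of radius [r n] that [c] names, and [good c] says that these balls are
centred at points that form a Cauchy sequence with an explicit rate; the limit is
then the decoded point. The rate makes the decoding Borel: the limit lies in an
open [U] if and only if, for some [n], the ball around the [n]-th centre that
must contain the limit is included in [U]. *)
Lemma polish_cantor_retract (x0 : M) : polish M ->
  exists (code : borel_of M -> cantor) (dec : cantor -> borel_of M),
    [/\ borel_fun code, borel_fun dec & cancel code dec].
Proof.
move=> polM; have [complM [D [cD dD]]] := polM.
have [d dP] := dense_sequence x0 cD dD.
have d_near x n : exists i, (ball (d i) (r n))° x by exact: dP.
pose code (y : borel_of M) : cantor :=
  fun k => if unpickle k is Some (i, n) then `[< (ball (d i) (r n))° y >] else false.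
have codeE y i n : code y (pickle (i, n)) = `[< (ball (d i) (r n))° y >].
  by rewrite /code pickleK.
have /choice[idx idxP] : forall n : nat, exists c : cantor -> nat,
    (forall i, borel [set x : cantor | c x = i]) /\
    forall (x : cantor) (i : nat), x (pickle (i, n)) -> x (pickle (c x, n)).
  move=> n; have [c [bc cP]] := borel_least_index
    (fun i => borel_coord (pickle (i, n))).
  by exists c.
pose good (c : cantor) := forall n m,
  ball (d (idx n c)) (r n + r m) (d (idx m c)).
have bgood : @borel cantor good.
  apply: borel_all => n; apply: borel_all => m.
  have bij ij : @borel cantor [set c | (idx n c = ij.1 /\ idx m c = ij.2) /\
      ball (d ij.1) (r n + r m) (d ij.2)].
    apply: borel_and (borel_const _ _).
    by apply: borel_and; [exact: (idxP n).1|exact: (idxP m).1].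
  apply: eq_borel (borel_ex bij) => c /=; split; last by exists (idx n c, idx m c).
  by move=> [[i j] [/= [<- <-]]].
have /choice[dec decP] : forall c, exists y,
    (good c -> forall n, ball (d (idx n c)) (r n + r n) y) /\ (~ good c -> y = x0).
  move=> c; have [gc|ngc] := pselect (good c); last by exists x0.
  have [y yP] := cauchy_sequence_limit polM gc; by exists y.
have quarter (e : R) : 0 < e -> exists n, (r n + r n) + (r n + r n) <= e.
  move=> e0; have e40 : 0 < e / 2 / 2 by rewrite !divr_gt0.
  have [N /(_ N (leqnn N))/ltW Ne] := r_small e40; exists N.
  by rewrite [leRHS]splitr [e / 2]splitr !lerD.
exists code, (dec : cantor -> borel_of M); split.
- apply: borel_fun_cantor => k; rewrite /code.
  case: unpickle => [[i n]|]; last exact: borel_const.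
  apply: (@eq_borel (borel_of M) ((ball (d i) (r n))°)) => [y|].
    by split=> /asboolP.
  by apply: borel_gen; exact: open_interior.
- apply: borel_fun_generated => U oU.
  have bni ni : @borel cantor [set c | (good c /\ idx ni.1 c = ni.2) /\
      ball (d ni.2) (r ni.1 + r ni.1) `<=` U].
    apply: borel_and (borel_const _ _); apply: borel_and bgood _.
    exact: (idxP ni.1).1.
  apply: eq_borel (borel_or (borel_ex bni)
    (borel_and (borel_not bgood) (borel_const _ (U x0)))) => c /=.
  split=> [[[[n i] /= [[gc ci]]]|[ngc Ux0]]|Uc].
  + by apply; rewrite -ci; apply: (decP c).1.
  + by rewrite (decP c).2.
  have [gc|ngc] := pselect (good c); last by right; rewrite -(decP c).2.
  left; have /nbhs_ballP[e /= e0 eU] : nbhs (dec c) U by exact: open_nbhs_nbhs.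
  have [n ne] := quarter e e0.
  exists (n, idx n c); split=> // y ny; apply: eU; apply: le_ball ne _ _.
  by apply: ball_triangle ny; apply: ball_sym; apply: (decP c).1.
- move=> y; have near_y n : ball (d (idx n (code y))) (r n) y.
    have [i iy] := d_near y n; apply: interior_subset; apply/asboolP.
    by rewrite -codeE; apply: (idxP n).2 (i) _; rewrite codeE; exact/asboolP.
  have gy : good (code y).
    by move=> n m; apply: ball_triangle (near_y n) _; exact/ball_sym.
  apply: ball_eq => e e0; have [n ne] := quarter e e0.
  apply: le_ball ne _ _; apply: ball_triangle (le_ball _ (near_y n)).
    by apply: ball_sym; apply: (decP _).1.
  by rewrite lerDl ltW.
Qed.

End CantorRetract.

Lemma standard_cantor_retract (R : realType) (X : borelSpace) :
  standard_borel R X -> X ->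
  exists (code : X -> cantor) (dec : cantor -> X),
    [/\ borel_fun code, borel_fun dec & cancel code dec].
Proof.
move=> [M [h [polM [h' hK h'K] bh]]] x0.
have [code [dec [bcode bdec codeK]]] := polish_cantor_retract (h x0) polM.
exists (code \o h), (h' \o dec); split.
- by apply: borel_fun_comp bcode => B /bh.
- apply: borel_fun_comp bdec _ => B bB; apply/bh.
  by apply: eq_borel bB => x; rewrite /= hK.
- by move=> x /=; rewrite codeK hK.
Qed.

(** Conjugate by the retractions of the Cantor space onto [X] and [Y]. *)
Lemma lusin_novikov (R : realType) (X Y : borelSpace)
    (hX : standard_borel R X) (hY : standard_borel R Y) (P : set (X * Y)) :
  Y -> @borel (prod_space X Y) P -> (forall x, countable [set y | P (x, y)]) ->
  exists g : nat -> X -> Y, (forall n, borel_fun (g n)) /\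
    forall x y, P (x, y) -> exists n, g n x = y.
Proof.
move=> y0 bP cP.
have [[x0]|nX] := pselect (inhabited X); last first.
  exists (fun _ _ => y0); split=> [n|x]; first exact: borel_fun_cst.
  by case: nX; constructor.
have [cX [dX [bcX bdX cXK]]] := standard_cantor_retract hX x0.
have [cY [dY [bcY bdY cYK]]] := standard_cantor_retract hY y0.
(* the second coordinate is required to be the code of a point, since a
   point of [Y] can have uncountably many preimages under [dY] *)
pose Q := [set w : cantor * cantor | P (dX w.1, dY w.2) /\ cY (dY w.2) = w.2].
have bQ : @borel (prod_space cantor cantor) Q.
  have bd1 := borel_fun_comp (@borel_fun_fst cantor cantor) bdX.
  have bd2 := borel_fun_comp (@borel_fun_snd cantor cantor) bdY.
  apply: borel_and; first exact: (borel_fun_pair bd1 bd2 bP).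
  have := borel_not (borel_neq (borel_fun_comp bd2 bcY)
                                (@borel_fun_snd cantor cantor)).
  by apply: eq_borel => w /=; split=> [/contrapT|wE /(_ wE)].
have cQ x : countable [set y | Q (x, y)].
  apply: sub_countable (cP (dX x)); apply: card_le_trans (card_image_le cY _).
  apply: subset_card_le => y [/= Pxy <-].
  by exists (dY y).
have [g bg gQ] := lusin_novikov_cantor bQ cQ.
exists (fun n => dY \o g n \o cX); split=> [n|x y Pxy].
  exact: borel_fun_comp bcX (borel_fun_comp (bg n) bdY).
have [|n gn] := gQ (cX x) (cY y); first by split; rewrite /= ?cXK ?cYK.
by exists n; rewrite /= -gn cYK.
Qed.

(** * Homomorphisms out of countable Borel equivalence relations *)

(** Since the covering functions are total, [P (x, g n x)] is a Borel condition
on [x], and the least [n] that satisfies it gives the uniformization. *)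
Lemma borel_uniformization (R : realType) (X Y : borelSpace)
    (hX : standard_borel R X) (hY : standard_borel R Y) (P : set (X * Y)) :
  Y -> @borel (prod_space X Y) P -> (forall x, countable [set y | P (x, y)]) ->
  borel [set x | exists y, P (x, y)] /\
  exists2 h : X -> Y, borel_fun h & forall x y, P (x, y) -> P (x, h x).
Proof.
move=> y0 bP cP; have [g [bg gP]] := lusin_novikov hX hY y0 bP cP.
have bA n : borel [set x | P (x, g n x)].
  exact: (borel_fun_pair (@borel_fun_id _) (bg n)).
split.
  apply: eq_borel (borel_ex bA) => x /=; split=> [[n]|[y /[dup] Pxy]].
    by exists (g n x).
  by move=> /gP[n gy]; exists n; rewrite gy.
have [c [bc cP']] := borel_least_index bA.
exists (fun x => g (c x) x); first exact: borel_fun_nat.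
by move=> x y /[dup] Pxy /gP[n gy]; apply: (cP' x n); rewrite /= gy.
Qed.

(** The weak form of the Feldman-Moore theorem: the covering functions are
corrected to stay inside the classes. *)
Lemma class_enumeration (R : realType) (X : borelSpace)
    (hX : standard_borel R X) (F : relation X) :
  countable_borel_equivalence F ->
  exists g : nat -> X -> X, (forall n, borel_fun (g n)) /\
    forall x y, F x y <-> exists n, g n x = y.
Proof.
move=> [eqF bF cF].
have [x0|nX] := pselect (inhabited X); last first.
  exists (fun _ x => x); split=> [n|x]; first exact: borel_fun_id.
  by case: nX; constructor.
case: x0 => x0.
have [g [bg gP]] := lusin_novikov (P := [set p | F p.1 p.2]) hX hX x0 bF cF.
have bD n : borel [set x | F x (g n x)].
  exact: (borel_fun_pair (@borel_fun_id _) (bg n) bF).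
exists (fun n x => if pselect (F x (g n x)) then g n x else x); split=> [n|x y].
  exact: (borel_fun_if (bD n) (bg n) (@borel_fun_id _)).
split=> [/[dup] Fxy /(gP x y)[n gy]|[n]]; last first.
  by case: pselect => Fg gy; rewrite -gy//; exact: Equivalence_Reflexive.
by exists n; rewrite gy; case: pselect.
Qed.

Lemma borel_non_empty (A : invariant_relation) (Phi : set (set A.-plus))
    (X : borelSpace) (E : relation X) : ~ inhabited X -> borel_non Phi E.
Proof.
move=> nX phi _ _.
have nX' (x : X) : False by apply: nX; constructor.
exists (fun x => False_rect _ (nX' x)); last by move=> x; exfalso; exact: nX' x.
split=> [B _|x]; last by exfalso; exact: nX' x.
by apply: eq_borel (borel_const X False) => x; exfalso; exact: nX' x.
Qed.

(** Pull [phi] back along [r], and the function obtained for it along [i]. As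
[r (i z)] is in the class of [z], every value [phi z n] is also a value of [phi]
at [r (i z)], and these are avoided. *)
Lemma borel_non_transfer (A : invariant_relation) (Phi : set (set A.-plus))
    (X Z : borelSpace) (E : relation X) (G : relation Z)
    (i : Z -> X) (r : X -> Z) :
  borel_hom G E i -> borel_hom E G r -> (forall z, G z (r (i z))) ->
  borel_non Phi E -> borel_non Phi G.
Proof.
move=> [bi hi] [br hr] Gri nonE phi [bphi hphi] Phiphi.
have [||psi [bpsi hpsi] psiP] := nonE (phi \o r).
- by split=> [|x x' /hr/hphi]; first exact: borel_fun_comp br bphi.
- by move=> x; exact: Phiphi.
exists (psi \o i); first by split=> [|z z' /hi/hpsi]; first exact: borel_fun_comp.
move=> z n.
have : range (phi (r (i z))) (phi z n) by rewrite -(hphi _ _ (Gri z)); exists n.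
by move=> [m _ <-]; exact: psiP.
Qed.

(** For fixed [y] the points [x] with [F y (f x)] form a single [E]-class or none,
because [f] is a reduction; so uniformization applies and provides a Borel
inverse of [f] up to equivalence, on the saturation of the range of [f].
Elsewhere a constant is still a homomorphism. *)
Lemma borel_non_reducible (R : realType) (X Y : borelSpace)
    (hX : standard_borel R X) (hY : standard_borel R Y)
    (E : relation X) (F : relation Y)
    (A : invariant_relation) (Phi : set (set A.-plus)) :
  countable_borel_equivalence E -> countable_borel_equivalence F ->
  borel_reducible E F -> borel_non Phi F -> borel_non Phi E.
Proof.
move=> [eqE bE cE] [eqF bF cF] [f [bf fP]].
have [[x0]|nX] := pselect (inhabited X); last first.
  by move=> _; exact: borel_non_empty.
pose P := [set p : Y * X | F p.1 (f p.2)].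
have bP : @borel (prod_space Y X) P.
  exact: (borel_fun_pair (@borel_fun_fst Y X)
           (borel_fun_comp (@borel_fun_snd Y X) bf) bF).
have cP y : countable [set x | P (y, x)].
  have [[x Pyx]|nP] := pselect (exists x, P (y, x)); last first.
    rewrite (_ : [set x | _] = set0)//; apply/seteqP; split=> x //= Pyx.
    by apply: nP; exists x.
  apply: sub_countable (cE x); apply: subset_card_le => x' /= Pyx'; apply/fP.
  exact: Equivalence_Transitive (Equivalence_Symmetric _ _ Pyx) Pyx'.
have [bD [h bh hP]] := borel_uniformization hY hX x0 bP cP.
apply: (@borel_non_transfer _ _ _ _ _ _ f
  (fun y => if pselect (exists x, P (y, x)) then h y else x0)).
- by split=> // x x' /fP.
- split=> [|y y' Fyy']; first exact: (borel_fun_if bD bh (@borel_fun_cst _ _ x0)).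
  have sat u v : F u v -> (exists x, P (u, x)) -> exists x, P (v, x).
    move=> Fuv [x Pux]; exists x.
    exact: Equivalence_Transitive (Equivalence_Symmetric _ _ Fuv) Pux.
  case: pselect => /= Dy; case: pselect => /= Dy'.
  + have [x Pyx] := Dy; have [x' Py'x'] := Dy'.
    apply/fP; apply: Equivalence_Transitive (hP _ _ Py'x').
    apply: Equivalence_Transitive (Fyy').
    exact: Equivalence_Symmetric (hP _ _ Pyx).
  + by case: Dy'; exact: sat Fyy' Dy.
  + by case: Dy; exact: sat (Equivalence_Symmetric _ _ Fyy') Dy'.
  + exact: Equivalence_Reflexive.
- move=> x; have Pxx : P (f x, x) by exact: Equivalence_Reflexive.
  case: pselect => [?|nP] /=; last by case: nP; exists x.
  by apply/fP; exact: (hP (f x) x).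
Qed.

(** Uniformization chooses an equivalent point of [B] for every point whose class
meets [B], and shows that these points form a Borel set; off that invariant set
[r] can be constant. *)
Lemma borel_retraction (R : realType) (X : borelSpace)
    (hX : standard_borel R X) (E : relation X) (B : set X) :
  countable_borel_equivalence E -> borel B -> B !=set0 ->
  exists r : X -> subspace_of B, borel_hom E (restriction E B) r /\
    forall x y, B y -> E x y -> E x (set_val (r x)).
Proof.
move=> [eqE bE cE] bB [b Bb].
pose P := [set p : X * X | E p.1 p.2 /\ B p.2].
have bP : @borel (prod_space X X) P.
  exact: borel_and bE (borel_fun_snd bB).
have cP x : countable [set y | P (x, y)].
  by apply: sub_countable (cE x); apply: subset_card_le => y [].
have [bD [h bh hP]] := borel_uniformization hX hX b bP cP.
pose D := [set x | exists y, P (x, y)].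
pose s x := if pselect (D x) then h x else b.
have sB x : s x \in B.
  by rewrite inE /s; case: pselect => //= Dx; have [y /hP[]] := Dx.
have bs : borel_fun s := borel_fun_if bD bh (@borel_fun_cst _ _ b).
have [r rE] : exists r : X -> subspace_of B, forall x, set_val (r x) = s x.
  by exists (fun x => SigSub (sB x)).
exists r; split; last first.
  move=> x y By Exy; rewrite rE /s.
  case: pselect => [?|nD] /=; last by case: nD; exists y.
  by case: (hP x y).
split=> [|x x' Exx'].
  by apply: borel_fun_subspace; rewrite (funext rE).
rewrite /restriction !rE /s.
have sat u v : E u v -> D u -> D v.
  move=> Euv [y [Euy By]]; exists y; split=> //.
  exact: Equivalence_Transitive (Equivalence_Symmetric _ _ Euv) Euy.
case: pselect => /= Dx; case: pselect => /= Dx'.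
- have [y /hP[Exh _]] := Dx; have [y' /hP[Exh' _]] := Dx'.
  apply: Equivalence_Transitive Exh'.
  apply: Equivalence_Transitive Exx'.
  exact: Equivalence_Symmetric.
- by case: Dx'; exact: sat Exx' Dx.
- by case: Dx; exact: sat (Equivalence_Symmetric _ _ Exx') Dx'.
- exact: Equivalence_Reflexive.
Qed.

Lemma borel_hom_set_val (X : borelSpace) (E : relation X) (B : set X) :
  borel_hom (restriction E B) E set_val.
Proof. by split=> //; exact: borel_fun_set_val. Qed.

(** The sequence [phi' x] lists all the values of [phi] on the [F]-class of [x],
through a Borel enumeration of that class; its range depends only on the
class and is a union of families that have the property. *)
Lemma borel_non_superrelation (R : realType) (X : borelSpace)
    (hX : standard_borel R X) (E F : relation X)
    (A : invariant_relation) (Phi : set (set A.-plus)) :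
  countable_borel_equivalence F -> subrel_of E F -> closed_under_unions Phi ->
  borel_non Phi F -> borel_non Phi E.
Proof.
move=> cbF EF PhiU nonF phi [bphi hphi] Phiphi.
have [g [bg gP]] := class_enumeration hX cbF; case: cbF => eqF _ _.
pose phi' x : power_space A.-plus :=
  fun k => if unpickle k is Some (n, m) then phi (g n x) m else phi x 0.
have rphi' x : range (phi' x) = \bigcup_(S in [set range (phi y) | y in F x]) S.
  apply/seteqP; split=> [_ [k _ <-]|_ [_ [y Fxy <-] [m _ <-]]].
    rewrite /phi'; case: unpickle => [[n m]|].
      exists (range (phi (g n x))); last by exists m.
      by exists (g n x) => //; apply/gP; exists n.
    by exists (range (phi x)); [exists x => //; exact: Equivalence_Reflexive|exists 0].
  have [n <-] := (gP x y).1 Fxy.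
  by exists (pickle (n, m)) => //; rewrite /phi' pickleK.
have [||psi [bpsi hpsi] psiP] := nonF phi'.
- split=> [|x x' Fxx'].
    apply: borel_fun_power => k; rewrite /phi'; case: unpickle => [[n m]|].
      exact: borel_fun_comp (borel_fun_comp (bg n) bphi) (@borel_fun_coord _ m).
    exact: borel_fun_comp bphi (@borel_fun_coord _ 0).
  rewrite /E_set !rphi'; congr bigcup; congr image; apply/seteqP; split=> y.
    exact: Equivalence_Transitive (Equivalence_Symmetric _ _ Fxx').
  exact: Equivalence_Transitive Fxx'.
- move=> x; rewrite rphi'; apply: PhiU => [|_ [y _ <-]//].
  by exists (range (phi x)); exists x => //; exact: Equivalence_Reflexive.
exists psi; first by split=> // x x' /EF/hpsi.
move=> x n; have : range (phi' x) (phi x n).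
  rewrite rphi'; exists (range (phi x)); last by exists n.
  by exists x => //; exact: Equivalence_Reflexive.
by move=> [m _ <-]; exact: psiP.
Qed.

Theorem theorem5p2 (R : realType) (X Y : borelSpace)
    (hX : standard_borel R X) (hY : standard_borel R Y)
    (E : relation X) (F : relation Y)
    (hE : countable_borel_equivalence E) (hF : countable_borel_equivalence F)
    (A : invariant_relation) (Phi : set (set A.-plus)) :
  [/\ (forall B : set X,
         borel_non Phi E -> borel B -> borel_non Phi (restriction E B)),
      (borel_reducible E F -> borel_non Phi F -> borel_non Phi E),
      (forall B : set X,
         borel B -> full_for E B -> borel_non Phi (restriction E B) ->
         borel_non Phi E),
      (forall F' : relation X, countable_borel_equivalence F' ->
         subrel_of E F' -> smooth_over F' E -> borel_non Phi E ->
         borel_non Phi F') &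
      (forall F' : relation X, countable_borel_equivalence F' ->
         subrel_of E F' -> borel_non Phi F' -> closed_under_unions Phi ->
         borel_non Phi E)].
Proof.
have [eqE _ _] := hE; split.
- move=> B nonE bB; have [B0|nB] := pselect (B !=set0); last first.
    apply: borel_non_empty => -[x]; apply: nB.
    by exists (set_val x); exact: set_valP.
  have [r [hr rP]] := borel_retraction hX hE bB B0.
  apply: (borel_non_transfer (borel_hom_set_val E B) hr) nonE => z.
  apply: (rP (set_val z) (set_val z)); first exact: set_valP.
  exact: Equivalence_Reflexive.
- exact: borel_non_reducible hX hY _ _ _ _ hE hF.
- move=> B bB fB nonEB; have [[x0]|nX] := pselect (inhabited X); last first.
    exact: borel_non_empty.
  have [b Bb _] := fB x0.
  have [r [hr rP]] := borel_retraction hX hE bB (ex_intro _ b Bb).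
  apply: (borel_non_transfer hr (borel_hom_set_val E B)) nonEB => z.
  by have [y By Ezy] := fB z; exact: rP By Ezy.
- move=> F' hF' EF' [f [hf fP]].
  apply: (@borel_non_transfer _ _ _ _ _ _ f id) => //.
  by split=> //; exact: borel_fun_id.
- move=> F' hF' EF' nonF' PhiU.
  exact: (borel_non_superrelation hX hF' EF' PhiU nonF').
Qed.
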